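(* Let $X$ and $Y$ be Asplund spaces, let $F\colon X\rightrightarrows Y$ be a set-valued mapping with closed convex graph, and let $\varphi\colon X\times Y\to(-\infty,\infty]$ be a lower semicontinuous convex function. Define the optimal value function $$\mu(x):=\inf\{\varphi(x,y)\mid y\in F(x)\},\qquad x\in X,$$ and assume that $\mu(x)>-\infty$ for all $x\in X$. Let $\bar x\in X$ with $\mu(\bar x)<\infty$, and assume that the solution set $$S(\bar x):=\{y\in F(\bar x)\mid \mu(\bar x)=\varphi(\bar x,y)\}$$ is nonempty. Let $\bar y\in S(\bar x)$. Assume the qualification condition $$\partial^\infty\varphi(\bar x,\bar y)\cap\big[-N((\bar x,\bar y);\operatorname{gph}F)\big]=\{(0,0)\},$$ and that either $\varphi$ is SNEC at $(\bar x,\bar y)$ or $\operatorname{gph}F$ is SNC at $(\bar x,\bar y)$. Then $$\partial\mu(\bar x)=\bigcup_{(u,v)\in\partial\varphi(\bar x,\bar y)}\big[u+D^*F(\bar x,\bar y)(v)\big].$$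
   Context: Convention: $\inf\emptyset=\infty$. The graph of $F$ is $\operatorname{gph}F=\{(x,y)\mid y\in F(x)\}$. For a convex set $\Omega$ in a Banach space $Z$ and $\bar z\in\Omega$, $N(\bar z;\Omega)=\{z^*\in Z^*\mid \langle z^*,z-\bar z\rangle\le 0\ \text{for all } z\in\Omega\}$. For a convex function $\varphi\colon Z\to(-\infty,\infty]$ and $\bar z$ with $\varphi(\bar z)<\infty$: the subdifferential is $\partial\varphi(\bar z)=\{z^*\in Z^*\mid \langle z^*,z-\bar z\rangle\le\varphi(z)-\varphi(\bar z)\ \text{for all } z\in Z\}$, and the singular subdifferential is $\partial^\infty\varphi(\bar z)=\{z^*\in Z^*\mid (z^*,0)\in N((\bar z,\varphi(\bar z));\operatorname{epi}\varphi)\}$. The coderivative of $F$ (with convex graph) at $(\bar x,\bar y)\in\operatorname{gph}F$ is $D^*F(\bar x,\bar y)(y^* )=\{x^*\in X^*\mid (x^*,-y^* )\in N((\bar x,\bar y);\operatorname{gph}F)\}$ for $y^*\in Y^*$. A nonempty closed (here convex) subset $\Omega$ of a Banach space is sequentially normally compact (SNC) at $\bar z\in\Omega$ if for all sequences $z_k\to\bar z$ with $z_k\in\Omega$ and $z_k^*\in N(z_k;\Omega)$, weak$^*$ convergence $z_k^*\to 0$ implies $\|z_k^*\|\to0$. A function $\varphi$ is SNEC (sequentially normally epi-compact) at $\bar z$ if $\operatorname{epi}\varphi$ is SNC at $(\bar z,\varphi(\bar z))$. *)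

(* Defs.v *)
From HB Require Import structures.
From mathcomp Require Import all_boot all_order all_algebra.
From mathcomp Require Import all_classical all_reals all_analysis.

Set Implicit Arguments.
Unset Strict Implicit.
Unset Printing Implicit Defensive.

Import Order.TTheory GRing.Theory Num.Theory.
Import numFieldNormedType.Exports.

Local Open Scope classical_set_scope.
Local Open Scope ring_scope.

Section dual_space.
Context (R : realType) (X : normedModType R).

Definition dual_pred : {pred X -> R^o} :=
  [pred f | `[< linear f /\ continuous f >]].

Lemma dual_predP (f : X -> R^o) :
  reflect (linear f /\ continuous f) (f \in dual_pred).
Proof. exact: asboolP. Qed.

Lemma dual_submod_closed : submod_closed dual_pred.
Proof.
split.
  apply/dual_predP; split; first by move=> a x y; rewrite scaler0 addr0.
  by move=> x; exact: cvg_cst.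
move=> a f g /dual_predP[lf cf] /dual_predP[lg cg]; apply/dual_predP; split.
  move=> b x y; change (a *: f (b *: x + y) + g (b *: x + y) =
    b *: (a *: f x + g x) + (a *: f y + g y)).
  rewrite lf lg !scalerDr !scalerA (mulrC a b) -!addrA; congr (_ + _).
  by rewrite addrCA.
move=> x; change ((fun y => a *: f y + g y) @ x --> a *: f x + g x).
by apply: cvgD; [apply: cvgZr; exact: cf|exact: cg].
Qed.

HB.instance Definition _ :=
  GRing.isSubmodClosed.Build R (X -> R^o) dual_pred dual_submod_closed.

(* The topological dual, with the pointwise linear structure. *)
Record dual_space := DualSpace
  { dual_fun :> X -> R^o ; dual_funP : dual_fun \in dual_pred }.

HB.instance Definition _ := [isSub of dual_space for dual_fun].
HB.instance Definition _ := [Choice of dual_space by <:].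
HB.instance Definition _ := [SubChoice_isSubLmodule of dual_space by <:].

Definition dual_norm (f : dual_space) : R :=
  sup [set `|f x| | x in [set x : X | `|x| <= 1]].

Definition weak_star_cvg0 (f : nat -> dual_space) : Prop :=
  forall x : X, (fun k => f k x) @ \oo --> (0 : R^o).

End dual_space.

Arguments dual_pred {R} X.

(* [dual_pair u v] is the functional (x, y) |-> <u, x> + <v, y>, i.e. the pair
   (u, v) under the identification of the dual of X * Y with the product of the
   duals. *)
Section dual_pair.
Context (R : realType) (X Y : normedModType R).

Definition dual_pair_fun (u : dual_space X) (v : dual_space Y) :
  X * Y -> R^o := fun z => u z.1 + v z.2.

Lemma dual_pair_subproof (u : dual_space X) (v : dual_space Y) :
  dual_pair_fun u v \in dual_pred (X * Y)%type.
Proof.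
have /dual_predP[lu cu] := dual_funP u; have /dual_predP[lv cv] := dual_funP v.
apply/dual_predP; split=> [a z w|z]; rewrite /dual_pair_fun.
  by rewrite /= lu lv scalerDr -!addrA; congr (_ + _); rewrite addrCA.
apply: cvgD.
  by apply: (cvg_comp _ _ (@cvg_fst _ _ _ _ _)); exact: cu.
by apply: (cvg_comp _ _ (@cvg_snd _ _ _ _ _)); exact: cv.
Qed.

Definition dual_pair (u : dual_space X) (v : dual_space Y) :
  dual_space (X * Y)%type := DualSpace (dual_pair_subproof u v).

End dual_pair.

Section asplund.
Context (R : realType).

(* [f] only matters on [U]; the library's [differentiable] is Frechet
   differentiability. *)
Definition asplund (X : normedModType R) : Prop :=
  forall (U : set X) (f : X -> R^o),
    open U -> convex_set U -> convex_function U f -> {in U, continuous f} ->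
    U `<=` closure (U `&` [set x | differentiable f x]).

End asplund.

Section convex_analysis.
Context (R : realType) (Z : normedModType R).
Implicit Types (Omega : set Z) (phi : Z -> \bar R) (z : Z).

Definition ereal_convex phi : Prop :=
  forall (x y : Z) (t : R), 0 < t -> t < 1 ->
    (phi (t *: x + (1 - t) *: y)%R <= t%:E * phi x + (1 - t)%R%:E * phi y)%E.

Definition epigraph phi : set (Z * R^o)%type :=
  [set w | (phi w.1 <= w.2%:E)%E].

Definition normal_cone Omega z : set (dual_space Z) :=
  [set zs : dual_space Z | forall w, Omega w -> zs (w - z) <= 0].

(* Meaningful when [phi z] is finite, as is [singular_subdifferential]. *)
Definition subdifferential phi z : set (dual_space Z) :=
  [set zs : dual_space Z | forall w, ((zs (w - z)%R)%:E <= phi w - phi z)%E].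

Definition SNC Omega z : Prop :=
  forall (zk : nat -> Z) (zsk : nat -> dual_space Z),
    (forall k, Omega (zk k)) -> zk @ \oo --> z ->
    (forall k, normal_cone Omega (zk k) (zsk k)) ->
    weak_star_cvg0 zsk -> (fun k => dual_norm (zsk k)) @ \oo --> (0 : R).

End convex_analysis.

Section epigraphical.
Context (R : realType) (Z : normedModType R).
Implicit Types (phi : Z -> \bar R) (z : Z).

Definition singular_subdifferential phi z : set (dual_space Z) :=
  [set zs | normal_cone (epigraph phi) (z, fine (phi z)) (dual_pair zs 0)].

Definition SNEC phi z : Prop := SNC (epigraph phi) (z, fine (phi z)).

End epigraphical.

Section set_valued.
Context (R : realType) (X Y : normedModType R).
Implicit Types (F : X -> set Y) (phi : X * Y -> \bar R).

Definition gph F : set (X * Y)%type := [set z | F z.1 z.2].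

Definition coderivative F (z : X * Y) (ys : dual_space Y) :
    set (dual_space X) :=
  [set xs | normal_cone (gph F) z (dual_pair xs (- ys))].

Definition optimal_value phi F (x : X) : \bar R :=
  ereal_inf [set phi (x, y) | y in F x].

Definition solution_set phi F (x : X) : set Y :=
  [set y | F x y /\ optimal_value phi F x = phi (x, y)].

End set_valued.

(* Main.v *)
Require Import Defs.
From HB Require Import structures.
From mathcomp Require Import all_boot all_order all_algebra.
From mathcomp Require Import all_classical all_reals all_analysis.
From mathcomp Require Import lra ring.

(* By definition of the coderivative the theorem is the sum rule for
   [phi + delta_(gph F)] at [z = (xb, yb)]. Let [zs] be a subgradient of that
   sum and put [A = epi phi] and
   [B = {(w, r) | w in gph F, r <= phi z + zs (w - z)}].
   An arbitrarily small vertical shift separates [A] from [B], so Ekeland's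
   principle applied to the distance between them, followed by Hahn-Banach,
   yields normals [n1 k] to [A] and [n2 k] to [B] at points tending to
   [(z, phi z)], with [n1 k + n2 k] tending to 0 in norm and [n1 k] of norm
   close to 1. Along any ultrafilter they converge pointwise to some [m] normal
   to [A] with [- m] normal to [B]. If some [m] is not horizontal, rescaling it
   splits [zs]; if every [m] is horizontal, the qualification condition forces
   [m = 0], so the whole sequence [n1 k] is weak* null, and SNC contradicts
   its norm being close to 1. *)

Set Implicit Arguments.
Unset Strict Implicit.
Unset Printing Implicit Defensive.
Import Order.TTheory GRing.Theory Num.Theory.
Import numFieldNormedType.Exports.

Local Open Scope classical_set_scope.
Local Open Scope ring_scope.

(** * Sublinear functionals and the Hahn-Banach theorem *)

Section hahn_banach.
Context {R : realType} {V : lmodType R}.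
Implicit Types p q : V -> R.

Definition sublinear p : Prop :=
  (forall x y, p (x + y) <= p x + p y) /\
  (forall t x, 0 < t -> p (t *: x) = t * p x).

Lemma sublinear0 p : sublinear p -> p 0 = 0.
Proof. by move=> [_ /(_ 2 0 ltac:(lra))]; rewrite scaler0; lra. Qed.

Lemma sublinear_ge p x : sublinear p -> - p (- x) <= p x.
Proof.
by move=> sp; have := sp.1 x (- x); rewrite subrr (sublinear0 sp); lra.
Qed.

(** This supplies lower bounds for Zorn's lemma. The bound [- q (- x)] makes each infimum genuine.
    For subadditivity, of two members of the chain the pointwise smaller one, evaluated at both
    points, stays below the mixed sum. *)
Lemma sublinear_inf_chain q (A : set (V -> R)) :
  A !=set0 ->
  (forall p, A p -> sublinear p /\ forall x, p x <= q x) ->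
  (forall p1 p2, A p1 -> A p2 ->
    (forall x, p1 x <= p2 x) \/ (forall x, p2 x <= p1 x)) ->
  let m x := inf [set p x | p in A] in
  sublinear m /\ forall p, A p -> forall x, m x <= p x.
Proof.
move=> [p0 Ap0] Aq Atot m.
have lbA x : has_lbound [set p x | p in A].
  exists (- q (- x)) => _ [p Ap <-].
  by have [sp pq] := Aq _ Ap; have := sublinear_ge x sp; have := pq (- x); lra.
have mle p x : A p -> m x <= p x by move=> Ap; apply: ge_inf => //; exists p.
have mge x r : (forall p, A p -> r <= p x) -> r <= m x.
  by move=> rA; apply: lb_le_inf; [exists (p0 x), p0|move=> _ [p Ap <-]; exact: rA].
split; last by move=> p Ap x; exact: mle.
split=> [x y|t x t0].
- rewrite -lerBlDr; apply: (mge) => p1 Ap1; rewrite lerBlDr -lerBlDl.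
  apply: (mge) => p2 Ap2; rewrite lerBlDl.
  have [p12|p21] := Atot _ _ Ap1 Ap2.
    have [[sp _] _] := Aq _ Ap1; rewrite (le_trans (mle _ _ Ap1))//.
    by rewrite (le_trans (sp _ _))// lerD2l.
  have [[sp _] _] := Aq _ Ap2; rewrite (le_trans (mle _ _ Ap2))//.
  by rewrite (le_trans (sp _ _))// lerD2r.
- apply/eqP; rewrite eq_le -ler_pdivrMl//; apply/andP; split; apply: (mge) => p Ap.
    by have [[_ sp] _] := Aq _ Ap; rewrite ler_pdivrMl// -sp// mle.
  by have [[_ sp] _] := Aq _ Ap; rewrite sp// ler_pM2l// mle.
Qed.

(* A sublinear [p] dominates every [fun x => inf_(t >= 0) p (x + t y) - t p y],
   so if [p] is minimal then taking [t = 1] makes [p] superadditive. *)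
Lemma minimal_sublinear_linear p : sublinear p ->
  (forall p', sublinear p' -> (forall x, p' x <= p x) -> p' = p) ->
  linear (p : V -> R^o).
Proof.
move=> sp pmin.
have padd y x : p x + p y <= p (x + y).
  pose S x := [set p (x + t *: y) - t * p y | t in [set t | 0 <= t]].
  pose p' x := inf (S x).
  have tpy t : 0 <= t -> p (t *: y) = t * p y.
    rewrite le_eqVlt => /predU1P[<-|]; last exact: sp.2.
    by rewrite scale0r mul0r (sublinear0 sp).
  have lbS z : has_lbound (S z).
    exists (- p (- z)) => _ [t /= t0 <-].
    have := sp.1 (z + t *: y) (- z); rewrite addrAC subrr add0r tpy//; lra.
  have le' z t : 0 <= t -> p' z <= p (z + t *: y) - t * p y.
    by move=> t0; apply: ge_inf => //; exists t.
  have mge z r : (forall t, 0 <= t -> r <= p (z + t *: y) - t * p y) -> r <= p' z.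
    move=> rA; apply: lb_le_inf => [|_ [t /= t0 <-]]; last exact: rA.
    by exists (p (z + 0 *: y) - 0 * p y), 0 => /=.
  have sp' : sublinear p'.
    split=> [z1 z2|t z t0].
      (* Parameters [t1] for [z1] and [t2] for [z2] give the competitor [t1 + t2] for [z1 + z2]. *)
      rewrite -lerBlDr; apply: (mge) => t1 t10; rewrite lerBlDr -lerBlDl.
      apply: (mge) => t2 t20; rewrite lerBlDl.
      rewrite (le_trans (le' _ (t1 + t2) (addr_ge0 t10 t20)))//.
      have := sp.1 (z1 + t1 *: y) (z2 + t2 *: y).
      by rewrite addrACA -scalerDl; lra.
    apply/eqP; rewrite eq_le -ler_pdivrMl//; apply/andP; split; apply: (mge) => s s0.
      rewrite ler_pdivrMl// mulrBr -(sp.2 _ (z + s *: y) t0) scalerDr scalerA mulrA.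
      by apply: le'; apply: mulr_ge0 => //; exact: ltW.
    have -> : t *: z + s *: y = t *: (z + (s / t) *: y).
      by rewrite scalerDr scalerA mulrCA divff ?gt_eqF// mulr1.
    rewrite sp.2// -[s * p y](_ : t * (s / t * p y) = _); last by field; rewrite gt_eqF.
    by rewrite -mulrBr ler_pM2l// le'// divr_ge0// ltW.
  have p'p z : p' z <= p z.
    by have := le' z 0 (lexx _); rewrite scale0r addr0 mul0r subr0.
  by have := le' x 1 ler01; rewrite (pmin _ sp' p'p) scale1r mul1r; lra.
have pD x y : p (x + y) = p x + p y by apply/eqP; rewrite eq_le sp.1 padd.
have pN x : p (- x) = - p x.
  by apply/eqP; rewrite -addr_eq0 -pD addNr (sublinear0 sp).
have pZ a x : p (a *: x) = a * p x.
  have [a0|a0|<-] := ltgtP 0 a; first exact: sp.2.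
    by have := sp.2 (- a) x; rewrite oppr_gt0 scaleNr pN mulNr => /(_ a0); lra.
  by rewrite scale0r mul0r (sublinear0 sp).
by move=> a x y /=; rewrite pD pZ.
Qed.

(** Zorn's lemma provides a minimal sublinear functional below [q], and minimality forces
    linearity. *)
Theorem sublinear_dominates_linear q : sublinear q ->
  exists l : V -> R^o, linear l /\ forall x, l x <= q x.
Proof.
move=> sq.
pose P p := sublinear p /\ forall x, p x <= q x.
pose T := {p : V -> R | P p}.
(* The pointwise order is reversed, so that a maximal element is a minimal functional. *)
pose ord (p1 p2 : T) := `[< forall x, sval p2 x <= sval p1 x >].
have [|p1 p2 p3 /asboolP h1 /asboolP h2|
  [p1 h1] [p2 h2] /asboolP p12 /asboolP p21|A Atot|[p [sp pq]] pmin] :=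
  @Zorn T ord.
- by move=> p; apply/asboolP.
- by apply/asboolP => x; exact: le_trans (h2 x) (h1 x).
- apply: eq_exist; apply/funext => x.
  by apply/eqP; rewrite eq_le (p12 x) (p21 x).
- have [[p0 Ap0]|A0] := pselect (A !=set0); last first.
    (* The empty chain is bounded by [q] itself. *)
    exists (exist P q (conj sq (fun x => lexx (q x)))) => p Ap.
    by exfalso; apply: A0; exists p.
  have [|_ [p _ <-]|_ _ [p1 Ap1 <-] [p2 Ap2 <-]|sm mle] :=
    @sublinear_inf_chain q [set sval p | p in A].
  + by exists (sval p0), p0.
  + exact: (svalP p).
  + by have [/asboolP|/asboolP] := Atot _ _ Ap1 Ap2; [right|left].
  + have mq x : inf [set p x | p in [set sval p | p in A]] <= q x.
      by apply: le_trans (mle (sval p0) _ x) ((svalP p0).2 x); exists p0.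
    exists (exist P _ (conj sm mq)) => p Ap; apply/asboolP => x /=.
    by apply: mle; exists p.
- exists p; split=> //; apply: minimal_sublinear_linear => // p' sp' p'p.
  have p'q x : p' x <= q x := le_trans (p'p x) (pq x).
  suff /pmin[] : ord (exist P p (conj sp pq)) (exist P p' (conj sp' p'q)) by [].
  exact/asboolP.
Qed.

End hahn_banach.

(** * Continuous linear functionals and the dual norm *)

Section dual_space_theory.
Context {R : realType} {V : normedModType R}.
Implicit Types n : dual_space V.

Lemma dual_linear n : linear n.
Proof. by have /dual_predP[] := dual_funP n. Qed.

HB.instance Definition _ n := GRing.isLinear.Build R V R^o _ n (dual_linear n).

Lemma dual_continuous n : continuous n.
Proof. by have /dual_predP[] := dual_funP n. Qed.

Lemma dual_bounded n : exists2 M : R, 0 <= M & forall h, `|n h| <= M * `|h|.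
Proof.
have /linear_bounded_continuous/linear_boundedP [M [_ nM]] :=
  @dual_continuous n.
exists (`|M| + 1); first by rewrite addr_ge0.
by apply: nM; rewrite (le_lt_trans (ler_norm M))// ltrDl.
Qed.

(** A one-sided bound is enough: applied to [- h], it bounds [f h] from below. *)
Lemma dual_of_le (f : V -> R^o) (M : R) :
  linear f -> (forall h, f h <= M * `|h|) ->
  exists n : dual_space V, forall h, n h = f h.
Proof.
move=> lf fM; pose F := GRing.isLinear.Build R V R^o _ f lf.
pose g : {linear V -> R^o} := HB.pack f F.
have cf : continuous f.
  apply/(@linear_bounded_continuous _ _ _ g)/linear_boundedP.
  exists M; split=> [|r Mr x /=]; first exact: num_real.
  rewrite ler_norml; apply/andP; split; last first.
    by rewrite (le_trans (fM x))// ler_wpM2r// ltW.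
  rewrite lerNl -(linearN g)/=.
  by rewrite (le_trans (fM _))// normrN ler_wpM2r// ltW.
have fP : f \in dual_pred V by apply/dual_predP.
by exists (DualSpace fP).
Qed.

Lemma le_dual_norm n h : `|n h| <= dual_norm n * `|h|.
Proof.
have [->|h0] := eqVneq h 0; first by rewrite linear0 !normr0 mulr0.
rewrite -ler_pdivrMr ?normr_gt0//.
have [M M0 nM] := dual_bounded n.
apply: ub_le_sup.
  by exists M => _ [x /= x1 <-]; rewrite (le_trans (nM x))// ler_piMr.
exists (`|h|^-1 *: h); first by rewrite /= normrZ normfV normr_id mulVf ?normr_eq0.
by rewrite linearZ normrZ normfV normr_id mulrC.
Qed.

Lemma dualNE n h : (- n) h = - n h.
Proof. by []. Qed.

Lemma dualDE n1 n2 h : (n1 + n2) h = n1 h + n2 h.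
Proof. by []. Qed.

Lemma dualZE (a : R) n h : (a *: n) h = a * n h.
Proof. by []. Qed.

Lemma dual_ext n1 n2 : (forall h, n1 h = n2 h) -> n1 = n2.
Proof. by move=> n12; apply/val_inj/funext. Qed.

End dual_space_theory.

(** * Multipliers for convex minimisation over a convex set *)

Lemma convex_setP {R : realType} {M : lmodType R} (A : set M) :
  convex_set A <-> forall x y (t : R), 0 < t -> t < 1 -> A x -> A y ->
    A (t *: x + (1 - t) *: y).
Proof.
rewrite convex_setW; split=> [cA x y t t0 t1 Ax Ay|cA x y].
  have t01 : Itv.spec (@Itv.num_sem _) (Itv.Real `[0%Z, 1%Z]) t.
    by rewrite /Itv.num_sem/= num_real in_itv/= !ltW.
  have := cA x y (mem_set Ax) (mem_set Ay) (Itv.mk t01) t0 t1.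
  by rewrite inE.
move=> /set_mem Ax /set_mem Ay k k0 k1; apply/mem_set.
exact: (cA x y k%:num k0 k1 Ax Ay).
Qed.

Section convex_multiplier.
Context {R : realType} {V : normedModType R}.
Variables (C : set V) (g : V -> R) (c0 : V) (L : R).
Hypothesis convexC : convex_set C.
Hypothesis convexg : forall x y t, 0 < t -> t < 1 ->
  g (t *: x + (1 - t) *: y) <= t * g x + (1 - t) * g y.
Hypothesis lipg : forall x y, g x - g y <= L * `|x - y|.
Hypothesis Cc0 : C c0.
Hypothesis gmin : forall c, C c -> g c0 <= g c.

Let S h := [set (g (w.2 + w.1 *: h) - g c0) / w.1 |
  w in [set w : R * V | 0 < w.1 /\ C w.2]].
Let q h := inf (S h).

(* The value of [q] at [h] is the infimum of the difference quotients of [g] in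
   direction [h] with base point relaxed to [C]; any linear minorant of [q] is
   both a subgradient of [g] at [c0] and nonnegative on [C - c0]. *)
Lemma convex_min_multiplier : exists n : dual_space V,
  (forall h, n h <= g (c0 + h) - g c0) /\ (forall c, C c -> 0 <= n (c - c0)).
Proof.
(* Minimality of [c0] on [C] allows [g c0] to be replaced by [g c], and the Lipschitz bound then
   applies. *)
have lbS h : lbound (S h) (- (L * `|h|)).
  move=> _ [[s c]/= [s0 Cc] <-]; rewrite ler_pdivlMr// mulNr lerNl.
  have := lipg c (c + s *: h); rewrite opprD addNKr normrN normrZ gtr0_norm//.
  by have := gmin Cc; rewrite mulrCA -mulrA mulrC; lra.
have qle h s c : 0 < s -> C c -> q h <= (g (c + s *: h) - g c0) / s.
  by move=> s0 Cc; apply: ge_inf; [exists (- (L * `|h|))|exists (s, c)].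
have qge h r : (forall s c, 0 < s -> C c -> r <= (g (c + s *: h) - g c0) / s) ->
    r <= q h.
  move=> rS; apply: lb_le_inf; last by move=> _ [[s c]/= [s0 Cc] <-]; exact: rS.
  by exists ((g (c0 + 1 *: h) - g c0) / 1), (1, c0).
have sq : sublinear q.
  split=> [h1 h2|t h t0].
    rewrite -lerBlDr; apply: (qge) => s1 c1 s10 Cc1; rewrite lerBlDr -lerBlDl.
    apply: (qge) => s2 c2 s20 Cc2; rewrite lerBlDl.
    (* These weights satisfy [t * s1 = (1 - t) * s2 = s], so the convex combination of the two
       displaced points moves along [h1 + h2] with step [s]. *)
    pose t := s2 / (s1 + s2); pose s := s1 * s2 / (s1 + s2).
    have s120 : 0 < s1 + s2 by rewrite addr_gt0.
    have t0 : 0 < t by rewrite divr_gt0.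
    have t1 : t < 1 by rewrite ltr_pdivrMr// mul1r ltrDr.
    have s0 : 0 < s by rewrite divr_gt0// mulr_gt0.
    have Cc : C (t *: c1 + (1 - t) *: c2) by exact: (convex_setP _).1.
    apply: le_trans (qle _ _ _ s0 Cc) _.
    have -> : t *: c1 + (1 - t) *: c2 + s *: (h1 + h2) =
        t *: (c1 + s1 *: h1) + (1 - t) *: (c2 + s2 *: h2).
      rewrite !scalerDr !scalerA addrACA; congr (_ + _ *: _ + (_ + _ *: _)).
        by rewrite /s /t; field; rewrite gt_eqF.
      by rewrite /s /t; field; rewrite gt_eqF.
    rewrite ler_pdivrMr//.
    have -> : ((g (c1 + s1 *: h1) - g c0) / s1 +
        (g (c2 + s2 *: h2) - g c0) / s2) * s =
        t * (g (c1 + s1 *: h1)) + (1 - t) * g (c2 + s2 *: h2) - g c0.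
      by rewrite /s /t; field; rewrite !gt_eqF.
    by rewrite lerD2r convexg.
  apply/eqP; rewrite eq_le -ler_pdivrMl//; apply/andP; split;
    apply: (qge) => s c s0 Cc.
    rewrite ler_pdivrMl//.
    have st : 0 < s / t by rewrite divr_gt0.
    apply: le_trans (qle _ _ _ st Cc) _.
    rewrite scalerA divfK ?gt_eqF// invf_div mulrCA mulrA; lra.
  have st : 0 < s * t by rewrite mulr_gt0.
  rewrite scalerA -ler_pdivlMl//.
  apply: le_trans (qle _ _ _ st Cc) _.
  by rewrite invfM; lra.
have [l [ll lq]] := sublinear_dominates_linear sq.
have lg h : l h <= g (c0 + h) - g c0.
  apply: le_trans (lq h) _.
  by have := qle h _ _ ltr01 Cc0; rewrite scale1r divr1.
have lL h : l h <= L * `|h|.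
  by apply: le_trans (lg h) _; have := lipg (c0 + h) c0; rewrite addrAC subrr add0r.
have [n nl] := dual_of_le ll lL.
exists n; split=> [h|c Cc]; first by rewrite nl.
(* From base point [c], the unit step in direction [c0 - c] lands on [c0], so its quotient is 0. *)
rewrite -[c - c0]opprB linearN/= oppr_ge0 nl; apply: le_trans (lq _) _.
by have := qle (c0 - c) _ _ ltr01 Cc; rewrite scale1r subrKC subrr mul0r.
Qed.

End convex_multiplier.

(** * Completeness of products *)

Section completeness.
Context {R : realType}.

(* A predicate rather than [completeNormedModType], because the library has no
   instance of the latter on products. *)
Definition complete_space (V : normedModType R) : Prop :=
  forall F : set_system V, ProperFilter F -> cauchy F -> exists l : V, F --> l.

Lemma complete_spaceT (V : completeNormedModType R) : complete_space V.
Proof. by move=> F FF cF; apply/cvg_ex; exact: cauchy_cvg cF. Qed.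

Lemma complete_prod (V W : normedModType R) :
  complete_space V -> complete_space W -> complete_space (V * W)%type.
Proof.
move=> cV cW F FF /cauchyP cF.
have c1 : cauchy (fst @ F).
  apply/cauchyP => e e0; have [w Fw] := cF e e0; exists w.1.
  by rewrite /fmap/=; apply: filterS Fw => v [].
have c2 : cauchy (snd @ F).
  apply/cauchyP => e e0; have [w Fw] := cF e e0; exists w.2.
  by rewrite /fmap/=; apply: filterS Fw => v [].
have [a Fa] := cV _ (fmap_proper_filter fst FF) c1.
have [b Fb] := cW _ (fmap_proper_filter snd FF) c2.
exists (a, b).
have -> : F = (fun w => (w.1, w.2)) @ F.
  by apply/funext => A; congr F; apply/funext => -[].
exact: cvg_pair.
Qed.

End completeness.

(** * Ekeland's variational principle *)

Section ekeland.
Context {R : realType} {V : normedModType R}.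
Hypothesis completeV : complete_space V.
Variables (C : set V) (f : V -> R) (c0 : V) (e : R).
Hypothesis closedC : closed C.
Hypothesis contf : continuous (f : V -> R^o).
Hypothesis f_ge0 : forall c, C c -> 0 <= f c.
Hypothesis Cc0 : C c0.
Hypothesis e_gt0 : 0 < e.

(** The points of [C] below [x] in Ekeland's order. *)
Let T x := [set y | C y /\ f y + e * `|y - x| <= f x].

Let T_trans x y z : T x y -> T y z -> T x z.
Proof.
move=> [_ xy] [Cz yz]; split=> //.
have : e * `|z - x| <= e * (`|z - y| + `|y - x|).
  by rewrite ler_pM2l// ler_distD.
by lra.
Qed.

Let T_closed x : closed (T x).
Proof.
apply: closedI => //.
have cg : continuous (fun y : V => f y + e * `|y - x| : R^o).
  move=> y; apply: cvgD; first exact: contf.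
  apply: cvgZr; apply: cvg_norm; apply: cvgB; [exact: cvg_id|exact: cvg_cst].
by apply: (@preimage_closed _ _ (fun y : V => f y + e * `|y - x| : R^o)
  [set r | r <= f x]).
Qed.

(** Each [u n.+1] is chosen to minimise [f] on [T (u n)] up to [n.+1%:R^-1], so the nested closed
    sets [T (u n)] shrink to a single point, the limit [c]. *)
Lemma ekeland : exists c, [/\ C c, f c + e * `|c - c0| <= f c0 &
  forall c', C c' -> f c <= f c' + e * `|c' - c|].
Proof.
have Tx x : C x -> T x x by move=> Cx; split=> //; rewrite subrr normr0 mulr0 addr0.
have /choice[next nextP] : forall nx : nat * V, exists y, C nx.2 ->
    T nx.2 y /\ forall z, T nx.2 z -> f y <= f z + nx.1.+1%:R^-1.
  move=> [n x]/=; have [Cx|nCx] := pselect (C x); last by exists x.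
  pose E := [set f y | y in T x].
  have infE : has_inf E.
    split; first by exists (f x), x => //; exact: Tx.
    by exists 0 => _ [y [Cy _] <-]; exact: f_ge0.
  have n0 : 0 < n.+1%:R^-1 :> R by rewrite invr_gt0.
  have [_ [y Txy <-] yE] := inf_adherent n0 infE.
  exists y => _; split=> // z Txz; apply: le_trans (ltW yE) _.
  by rewrite lerD2r; apply: ge_inf; [exact: infE.2|exists z].
pose u := fix u n := if n is n'.+1 then next (n', u n') else c0.
have Cu n : C (u n).
  by elim: n => [//|n Cun]; have [[]] := nextP (n, u n) Cun.
have uT n m : (n <= m)%N -> T (u n) (u m).
  elim: m => [|m IHm]; first by rewrite leqn0 => /eqP ->; exact: Tx.
  rewrite leq_eqVlt => /predU1P[->|/IHm]; first exact: Tx.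
  by move/T_trans; apply; have [] := nextP (m, u m) (Cu m).
(* Since [z] also lies in [T (u n)], near-minimality bounds the decrease [f (u n.+1) - f z], which
   in turn bounds the distance. *)
have Tsmall n z : T (u n.+1) z -> e * `|z - u n.+1| <= n.+1%:R^-1.
  move=> Tz.
  have [Tn /(_ _ (T_trans Tn Tz))] : T (u n) (u n.+1) /\
    forall z, T (u n) z -> f (u n.+1) <= f z + n.+1%:R^-1 := nextP (n, u n) (Cu n).
  by have [_] := Tz; move: n.+1%:R^-1 => r; lra.
have small eps : 0 < eps -> exists n, forall z, T (u n.+1) z -> `|z - u n.+1| < eps.
  move=> eps0; pose d := e * eps; have d0 : 0 < d by rewrite mulr_gt0.
  have [n _ nE] := cvgr_lt _ (@cvg_harmonic R) _ d0.
  exists n => z /Tsmall ze.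
  by rewrite -(ltr_pM2l e_gt0) (le_lt_trans ze)//; exact: nE (leqnn n).
have cu : cauchy (u @ \oo).
  apply/cauchyP => eps eps0; have [n nE] := small _ eps0.
  exists (u n.+1); exists n.+1 => // m /= nm.
  by rewrite -ball_normE/= distrC; apply: nE; exact: uT.
have [c uc] := completeV (fmap_proper_filter u _) cu.
have Tc n : T (u n) c.
  have nT : \forall m \near \oo, T (u n) (u m) by exists n => // m; exact: uT.
  exact: (closed_cvg (T (u n)) (@T_closed (u n)) nT _ uc).
exists c; have [Cc cE] := Tc 0; split=> // c' Cc'; rewrite leNgt; apply/negP => lt_c'c.
(* A point violating the inequality would lie with [c] in every [T (u n)], hence coincide with
   [c]. *)
have Tc' : T c c' by split=> //; exact: ltW.
have c'c : c' = c.
  apply/eqP; rewrite -subr_eq0 -normr_le0; apply/ler_addgt0Pr => eps eps0.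
  have eps20 : 0 < eps / 2 by rewrite divr_gt0.
  have [n nE] := small _ eps20.
  have := nE _ (Tc n.+1); have := nE _ (T_trans (Tc n.+1) Tc').
  move: (u n.+1) => v; have := ler_distD v c' c.
  by rewrite (distrC v c) add0r; lra.
by move: lt_c'c; rewrite c'c subrr normr0 mulr0 addr0 ltxx.
Qed.

End ekeland.

(** * Functionals on a product space *)

Section dual_product.
Context {R : realType} {V W : normedModType R}.

Lemma norm_fst_le (p : V * W) : `|p.1| <= `|p|.
Proof. by rewrite prod_normE le_max lexx. Qed.

Lemma norm_snd_le (p : V * W) : `|p.2| <= `|p|.
Proof. by rewrite prod_normE le_max lexx orbT. Qed.

Lemma dual_pairP (n : dual_space (V * W)%type) : exists u v, n = dual_pair u v.
Proof.
have [M M0 nM] := dual_bounded n.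
have lu : linear (fun h : V => n (h, 0) : R^o).
  by move=> a x y; rewrite -linearP; congr (n _); congr pair; rewrite /= scaler0 addr0.
have lv : linear (fun k : W => n (0, k) : R^o).
  by move=> a x y; rewrite -linearP; congr (n _); congr pair; rewrite /= scaler0 addr0.
have [|u uE] := @dual_of_le _ _ _ M lu.
  move=> h; apply: le_trans (ler_norm _) _; apply: le_trans (nM _) _.
  by rewrite prod_normE/= normr0 ler_wpM2l// ge_max lexx/=.
have [|v vE] := @dual_of_le _ _ _ M lv.
  move=> h; apply: le_trans (ler_norm _) _; apply: le_trans (nM _) _.
  by rewrite prod_normE/= normr0 ler_wpM2l// ge_max lexx/= andbT.
exists u, v; apply: dual_ext => -[h k]; rewrite /= /dual_pair_fun/= uE vE -linearD/=.
by congr (n _); congr pair; rewrite /= ?addr0 ?add0r.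
Qed.

End dual_product.

(** * An approximate extremal principle for two convex sets *)

Section extremal_principle.
Context {R : realType} {W : normedModType R}.
Hypothesis completeW : complete_space W.
Variables (A B : set W) (w a : W) (e : R).
Hypothesis closedA : closed A.
Hypothesis convexA : convex_set A.
Hypothesis closedB : closed B.
Hypothesis convexB : convex_set B.
Hypothesis Aw : A w.
Hypothesis Bw : B w.
Hypothesis e_gt0 : 0 < e.
Hypothesis norm_a : `|a| <= e * e.
Hypothesis disjoint_AB : forall x y, A x -> B y -> x - y + a != 0.

(** Ekeland's principle for the shifted distance [f] on the product of [A] and [B] gives a minimiser
    [p0] of the convex perturbation [g]. The two components of its multiplier are, up to sign, the
    required normals. *)
Lemma convex_extremal_principle : exists x y (n1 n2 : dual_space W),
  [/\ A x, B y, `|x - w| <= e & `|y - w| <= e] /\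
  [/\ normal_cone A x n1, normal_cone B y n2,
      forall h, `|n1 h + n2 h| <= e * `|h|,
      forall h, `|n1 h| <= (1 + e) * `|h| &
      exists2 v, v != 0 & (1 - e) * `|v| <= `|n1 v|].
Proof.
pose f (p : W * W) := `|p.1 - p.2 + a|.
pose C := [set p : W * W | A p.1 /\ B p.2].
have contf : continuous (f : W * W -> R^o).
  move=> p; apply: cvg_norm; apply: cvgD; last exact: cvg_cst.
  by apply: cvgB; [exact: cvg_fst|exact: cvg_snd].
have closedC : closed C.
  apply: closedI.
    by apply: preimage_closed => // p _; exact: cvg_fst.
  by apply: preimage_closed => // p _; exact: cvg_snd.
have convexC : convex_set C.
  apply/convex_setP => p q t t0 t1 [Ap Bp] [Aq Bq].
  by split=> /=; [move/convex_setP: convexA; exact|move/convex_setP: convexB; exact].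
have f_ge0 p : C p -> 0 <= f p by rewrite /f.
have [[x y] [[/= Ax By] fle fmin]] := ekeland (complete_prod completeW completeW)
  closedC contf f_ge0 (conj Aw Bw : C (w, w)) e_gt0.
set p0 := (x, y) in fle fmin.
(* Ekeland's estimate bounds [e] times this distance by [f (w, w) = |a|], whence the requirement
   that [a] have norm at most [e * e]. *)
have p0w : `|p0 - (w, w)| <= e.
  rewrite -(ler_pM2l e_gt0); apply: le_trans norm_a.
  have : f (w, w) = `|a| by rewrite /f/= subrr add0r.
  by have := f_ge0 p0 (conj Ax By); lra.
pose g p := f p + e * `|p - p0|.
have f_lip p q : f p - f q <= 2 * `|p - q|.
  have : f p - f q <= `|(p - q).1 - (p - q).2|.
    apply: le_trans (lerB_dist _ _) _.
    rewrite opprD addrACA subrr addr0 opprB /= opprB addrACA.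
    by rewrite [p.1 - q.1 + _]addrACA (addrC (- p.2)).
  have := ler_normB (p - q).1 (p - q).2.
  by have := norm_fst_le (p - q); have := norm_snd_le (p - q); lra.
have convexg p q t : 0 < t -> t < 1 ->
    g (t *: p + (1 - t) *: q) <= t * g p + (1 - t) * g q.
  move=> t0 t1; have t1' : 0 < 1 - t by rewrite subr_gt0.
  have cvxn (V : normedModType R) (h k : V) :
      `|t *: h + (1 - t) *: k| <= t * `|h| + (1 - t) * `|k|.
    by rewrite (le_trans (ler_normD _ _))// !normrZ !gtr0_norm.
  have -> : t * g p + (1 - t) * g q =
      (t * f p + (1 - t) * f q) + e * (t * `|p - p0| + (1 - t) * `|q - p0|).
    by rewrite /g; ring.
  have affine (V : normedModType R) (h k b : V) :
      t *: h + (1 - t) *: k + b = t *: (h + b) + (1 - t) *: (k + b).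
    by rewrite !scalerDr addrACA -scalerDl addrCA subrr addr0 scale1r.
  apply: lerD.
    rewrite /f/=.
    have -> : t *: p.1 + (1 - t) *: q.1 - (t *: p.2 + (1 - t) *: q.2) + a =
        t *: (p.1 - p.2 + a) + (1 - t) *: (q.1 - q.2 + a).
      by rewrite -affine !scalerBr opprD addrACA.
    exact: cvxn.
  by rewrite ler_pM2l// affine cvxn.
have lipg p q : g p - g q <= (2 + e) * `|p - q|.
  have : `|p - p0| - `|q - p0| <= `|p - q|.
    by apply: le_trans (lerB_dist _ _) _; rewrite opprB addrA subrK.
  by rewrite -(ler_pM2l e_gt0); have := f_lip p q; rewrite /g; lra.
have gmin p : C p -> g p0 <= g p.
  by move=> /fmin; rewrite /g subrr normr0 mulr0 addr0.
have [n [nle nge]] := convex_min_multiplier convexC convexg lipg (conj Ax By : C p0) gmin.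
have gp0 : g p0 = f p0 by rewrite /g subrr normr0 mulr0 addr0.
have gp0D h : g (p0 + h) = f (p0 + h) + e * `|h| by rewrite /g addrAC subrr add0r.
have nle' h : n h <= f (p0 + h) - f p0 + e * `|h|.
  by have := nle h; rewrite gp0 gp0D; lra.
have [u [v nE]] := dual_pairP n.
have nuv h k : n (h, k) = u h + v k by rewrite nE.
have norm_diag h : `|(h, h) : W * W| = `|h| by rewrite prod_normE/= maxxx.
have norm_inl h : `|(h, 0) : W * W| = `|h|.
  by rewrite prod_normE/= normr0; apply/max_idPl.
have u0 : u 0 = 0 by rewrite linear0.
have v0 : v 0 = 0 by rewrite linear0.
(* Diagonal displacements leave [f] unchanged, so only the perturbation contributes. *)
have uvle h : u h + v h <= e * `|h|.
  rewrite -nuv; apply: le_trans (nle' _) _; rewrite norm_diag /f/=.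
  by rewrite opprD addrACA subrr addr0 subrr add0r.
have ule h : u h <= (1 + e) * `|h|.
  have := nle' (h, 0); rewrite nuv v0 addr0 norm_inl /f/= addr0.
  have := lerB_dist (x + h - y + a) (x - y + a).
  by rewrite (addrAC x) (addrAC (x - y)) [_ + h - _]addrC addKr; lra.
exists x, y, (- u), (- v); split; split=> //.
- by apply: le_trans p0w; exact: (norm_fst_le (p0 - (w, w))).
- by apply: le_trans p0w; exact: (norm_snd_le (p0 - (w, w))).
- move=> z Az /=; rewrite oppr_le0.
  by have := nge (z, y) (conj Az By); rewrite nuv/= subrr v0 addr0.
- move=> z Bz /=; rewrite oppr_le0.
  by have := nge (x, z) (conj Ax Bz); rewrite nuv/= subrr u0 add0r.
- move=> h; rewrite !dualNE ler_norml; apply/andP; split.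
    by have := uvle h; lra.
  by have := uvle (- h); rewrite normrN !linearN/=; lra.
- move=> h; rewrite dualNE ler_norml; apply/andP; split.
    by have := ule h; lra.
  by have := ule (- h); rewrite normrN linearN/=; lra.
(* Moving the first coordinate by the opposite of this vector brings [f] down to 0, a decrease at
   unit rate; this gives the lower bound on [u]. *)
- exists (x - y + a); first exact: disjoint_AB.
  have := nle' (- (x - y + a), 0); rewrite nuv v0 addr0 norm_inl normrN linearN/=.
  rewrite {1}/f/= addr0 [x + _ - y + a](_ : _ = 0); last first.
    by rewrite (addrAC x) (addrAC (x - y)) subrr.
  by rewrite normr0 sub0r normrN; have := ler_norm (u (x - y + a)); rewrite /f/=; lra.
Qed.

End extremal_principle.

(** * Pointwise limits of functionals along ultrafilters *)

Section ultrafilter_limits.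
Context {R : realType}.

Lemma ultra_bounded_cvg {T : Type} (U : set_system T) (r : T -> R) (M : R) :
  UltraFilter U -> (forall k, `|r k| <= M) ->
  exists l : R, r k @[k --> U] --> (l : R^o).
Proof.
move=> UU rM.
have rU : U (r @^-1` `[- M, M]%classic).
  by apply: filterE => k /=; rewrite in_itv/= -ler_norml.
have [l [_ cl]] := @segment_compact R (- M) M (r @ U) _ rU.
exists l => B lB; have [//|UnB] := in_ultra_setVsetC (r @^-1` B) UU.
by have [x [nBx Bx]] := cl (~` B) B UnB lB.
Qed.

(** This allows weak* nullity of a sequence to be tested along ultrafilters, where bounded
    functionals always have pointwise limits. *)
Lemma cvg0_ultra (r : nat -> R) :
  (forall U, UltraFilter U -> \oo `<=` U -> r k @[k --> U] --> (0 : R^o)) ->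
  r k @[k --> \oo] --> (0 : R^o).
Proof.
move=> rU; apply/cvgr0Pnorm_lt => e e0; apply: contrapT => nre.
(* If [r] does not tend to 0, these indices meet every tail, so some ultrafilter finer than [\oo]
   contains [D]. *)
pose D := [set k | ~ `|r k| < e].
have PD : ProperFilter (within D \oo).
  apply: Build_ProperFilter => D0.
  have D0' : \oo [set k | D k -> False] := D0.
  by apply: nre; apply: filterS D0' => k nDk; apply: contrapT => /nDk.
have [U [UU DU]] := ultraFilterLemma PD.
have ooU : \oo `<=` U.
  by move=> B ooB; apply: DU; apply: filterS ooB => k Bk _.
have UD : U D by apply: DU; exact: withinT.
have Ue : U [set k | `|r k| < e]  by exact: cvgr0_norm_lt (rU U UU ooU) _ e0.
by have [k [nk /nk]] := filter_ex (filterI UD Ue).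
Qed.

Context {V : normedModType R}.

(** Weak* compactness of bounded sets of functionals: limits exist at each point, and linearity and
    the bound pass to them. *)
Lemma ultra_dual_cvg {T : Type} (U : set_system T) (n : T -> dual_space V)
    (M : R) : UltraFilter U -> (forall k h, `|n k h| <= M * `|h|) ->
  exists m : dual_space V, forall h, n k h @[k --> U] --> m h.
Proof.
move=> UU nM.
have /choice[l lP] h : exists l : R, n k h @[k --> U] --> (l : R^o).
  exact: ultra_bounded_cvg (nM^~ h).
have ll : linear (l : V -> R^o).
  move=> a x y; apply: (cvg_unique (@norm_hausdorff _ R^o) (lP (a *: x + y))).
  have -> : (fun k => n k (a *: x + y)) = (fun k => a *: (n k x : R^o) + n k y).
    by apply/funext => k; rewrite linearP.
  by apply: cvgD; [apply: cvgZr|]; exact: lP.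
have [|m mE] := @dual_of_le _ _ _ M ll; last by exists m => h; rewrite mE.
move=> h; apply/ler_addgt0Pr => e e0.
have Uh : U [set k | `|l h - n k h| < e] by exact: cvgr_dist_lt (lP h) _ e0.
have [k] := filter_ex Uh.
have := nM k h; have := ler_norm (n k h); have := ler_norm (l h - n k h).
by rewrite /=; lra.
Qed.

(** The moving base point is harmless: by the uniform bound, [n k (z - zk k)] tends to 0. *)
Lemma normal_cone_ultra_limit (A : set V) (z : V) (zk : nat -> V)
    (n : nat -> dual_space V) (m : dual_space V) (M : R) (U : set_system nat) :
  UltraFilter U -> \oo `<=` U -> (forall k h, `|n k h| <= M * `|h|) ->
  zk @ \oo --> z -> (forall k, normal_cone A (zk k) (n k)) ->
  (forall h, n k h @[k --> U] --> m h) -> normal_cone A z m.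
Proof.
move=> UU ooU nM zkz nA nm w Aw; apply/ler_addgt0Pr => e e0.
(* The sign of [M] is not prescribed, so a positive majorant serves as divisor. *)
have M1 : 0 < `|M| + 1 by rewrite ltr_wpDl.
have d0 : 0 < e / 2 / (`|M| + 1) by rewrite !divr_gt0.
have e20 : 0 < e / 2 by rewrite divr_gt0.
have Uz : U [set k | `|z - zk k| < e / 2 / (`|M| + 1)].
  by apply: ooU; exact: cvgr_dist_lt zkz _ d0.
have Um : U [set k | `|m (w - z) - n k (w - z)| < e / 2].
  exact: cvgr_dist_lt (nm (w - z)) _ e20.
have [k [/= zd md]] := filter_ex (filterI Uz Um).
have split_n : n k (w - z) = n k (w - zk k) - n k (z - zk k).
  by rewrite -linearB/= opprB addrA subrK.
have small : `|n k (z - zk k)| <= e / 2.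
  apply: le_trans (nM _ _) _; apply: (@le_trans _ _ ((`|M| + 1) * `|z - zk k|)).
    by rewrite ler_wpM2r// (le_trans (ler_norm M))// lerDl.
  by rewrite mulrC -ler_pdivlMr// ltW.
have := ler_norm (m (w - z) - n k (w - z)); have := nA k w Aw.
have := ler_norm (- n k (z - zk k)); rewrite normrN.
by rewrite split_n in md *; lra.
Qed.

End ultrafilter_limits.

(** * Closedness and convexity of epigraphs *)

Section epigraph_theory.
Context {R : realType} {Z : normedModType R}.
Implicit Types phi : Z -> \bar R.

Lemma closed_epigraph phi : lower_semicontinuous phi -> closed (epigraph phi).
Proof.
move=> lsc; rewrite -openC openE => -[w r] /= /negP; rewrite -ltNge => rphi.
(* A real level strictly between [r] and [phi w], chosen as [r + 1] when [phi w] is infinite. *)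
have [s [rs sphi]] : exists s : R, r < s /\ (s%:E < phi w)%E.
  move: rphi => /=; case: (phi w) => [t| |//]; rewrite ?lte_fin => rt.
    by exists ((r + t) / 2); rewrite lte_fin; split; lra.
  by exists (r + 1); rewrite ltry; split=> //; lra.
have [V wV Vs] := lsc w s sphi.
have rV : nbhs (r : R^o) [set t | t < s] by exact: lt_nbhsl.
exists (V, [set t | t < s]) => // -[v t] [/= Vv ts].
apply/negP; rewrite -ltNge; apply: lt_trans (Vs _ Vv).
by rewrite lte_fin.
Qed.

Lemma convex_epigraph phi : ereal_convex phi -> convex_set (epigraph phi).
Proof.
move=> cphi; apply/convex_setP => -[x r] [y s] t t0 t1 /= xr ys.
apply: le_trans (cphi x y t t0 t1) _.
rewrite [leRHS](_ : _ = t%:E * r%:E + (1 - t)%R%:E * s%:E)%E//.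
by apply: leeD; apply: lee_wpmul2l; rewrite // lee_fin ?subr_ge0 ltW.
Qed.

End epigraph_theory.

(** * Weak* null sequences of nearly opposite normals *)

Section extremal_sequences.
Context {R : realType} {W : normedModType R}.
Hypothesis completeW : complete_space W.
Variables (A B : set W) (w : W).
Hypothesis closedA : closed A.
Hypothesis convexA : convex_set A.
Hypothesis closedB : closed B.
Hypothesis convexB : convex_set B.
Hypothesis Aw : A w.
Hypothesis Bw : B w.
Hypothesis extremal : forall e, 0 < e -> exists2 a : W, `|a| <= e &
  forall x y, A x -> B y -> x - y + a != 0.
Hypothesis qualified : forall m : dual_space W,
  normal_cone A w m -> normal_cone B w (- m) -> m = 0.

Lemma cvg_harmonic_dist (z : nat -> W) :
  (forall k, `|z k - w| <= k.+1%:R^-1) -> z @ \oo --> w.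
Proof.
move=> zw; apply/cvgrPdist_lt => e e0.
have he : \forall k \near \oo, (k.+1%:R^-1 : R) < e.
  exact: cvgr_lt (@cvg_harmonic R) _ e0.
by apply: filterS he => k; rewrite distrC; exact: le_lt_trans.
Qed.

(** The extremal principle is used with accuracy [k.+1%:R^-1]. Along any ultrafilter finer than
    [\oo], [n1] has a pointwise limit [m] and [n2] then tends to [- m], so [qualified] gives
    [m = 0]. *)
Lemma extremal_sequences : exists (x y : nat -> W) (n1 n2 : nat -> dual_space W),
  [/\ forall k, A (x k), forall k, B (y k), x @ \oo --> w & y @ \oo --> w] /\
  [/\ forall k, normal_cone A (x k) (n1 k), forall k, normal_cone B (y k) (n2 k),
      forall k h, `|n1 k h + n2 k h| <= k.+1%:R^-1 * `|h|,
      weak_star_cvg0 n1 /\ weak_star_cvg0 n2 &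
      forall k, exists2 v, v != 0 & (1 - k.+1%:R^-1) * `|v| <= `|n1 k v|].
Proof.
have /choice[s sP] : forall k : nat, exists s : (W * W) * (dual_space W * dual_space W),
    [/\ A s.1.1, B s.1.2, `|s.1.1 - w| <= k.+1%:R^-1 & `|s.1.2 - w| <= k.+1%:R^-1] /\
    [/\ normal_cone A s.1.1 s.2.1, normal_cone B s.1.2 s.2.2,
      forall h, `|s.2.1 h + s.2.2 h| <= k.+1%:R^-1 * `|h|,
      forall h, `|s.2.1 h| <= (1 + k.+1%:R^-1) * `|h| &
      exists2 v, v != 0 & (1 - k.+1%:R^-1) * `|v| <= `|s.2.1 v|].
  move=> k; have e0 : 0 < k.+1%:R^-1 :> R by rewrite invr_gt0.
  have [a ae disj] := extremal (mulr_gt0 e0 e0).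
  have [x [y [n1 [n2 xyn]]]] := convex_extremal_principle completeW closedA
    convexA closedB convexB Aw Bw e0 ae disj.
  by exists ((x, y), (n1, n2)).
pose x k := (s k).1.1; pose y k := (s k).1.2.
pose n1 k := (s k).2.1; pose n2 k := (s k).2.2.
have Ax k : A (x k) by have [[]] := sP k.
have By k : B (y k) by have [[]] := sP k.
have xw : x @ \oo --> w by apply: cvg_harmonic_dist => k; have [[]] := sP k.
have yw : y @ \oo --> w by apply: cvg_harmonic_dist => k; have [[]] := sP k.
have n1A k : normal_cone A (x k) (n1 k) by have [_ []] := sP k.
have n2B k : normal_cone B (y k) (n2 k) by have [_ []] := sP k.
have n12 k h : `|n1 k h + n2 k h| <= k.+1%:R^-1 * `|h| by have [_ [_ _ /(_ h)]] := sP k.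
have inv1 k : k.+1%:R^-1 <= 1 :> R by rewrite invf_le1// ler1n.
(* The constant 2 bounds [1 + k.+1%:R^-1]; the constant 3 below adds the bound 1 on the sum of the
   two normals. *)
have n1M k h : `|n1 k h| <= 2 * `|h|.
  have [_ [_ _ _ /(_ h) n1h _]] := sP k; apply: le_trans n1h _.
  by rewrite ler_wpM2r//; have := inv1 k; move: k.+1%:R^-1 => ?; lra.
have n2M k h : `|n2 k h| <= 3 * `|h|.
  have -> : n2 k h = (n1 k h + n2 k h) - n1 k h by rewrite addrC addKr.
  apply: le_trans (ler_normB _ _) _.
  have := n12 k h; have := n1M k h; have := ler_wpM2r (normr_ge0 h) (inv1 k).
  by move: (k.+1%:R^-1) => ?; lra.
have n120 h : n1 k h + n2 k h @[k --> \oo] --> (0 : R^o).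
  have e0 : (k.+1%:R^-1 * `|h| : R^o) @[k --> \oo] --> (0 : R^o).
    by rewrite -[X in _ --> X](mul0r `|h|); apply: cvgMl; exact: cvg_harmonic.
  apply/cvgr0Pnorm_lt => e egt0.
  have he : \forall k \near \oo, (k.+1%:R^-1 * `|h| : R) < e.
    exact: cvgr_lt e0 _ egt0.
  by apply: filterS he => k; exact: le_lt_trans.
have n2E h : (fun k => n2 k h) = (fun k => (n1 k h + n2 k h) - n1 k h).
  by apply/funext => k; rewrite addrC addKr.
have n10 : weak_star_cvg0 n1.
  move=> h; apply: cvg0_ultra => U UU ooU.
  have [m n1m] := ultra_dual_cvg UU n1M.
  have n2m h' : n2 k h' @[k --> U] --> (- m) h'.
    rewrite n2E dualNE -[X in _ --> X]add0r; apply: cvgB; last exact: n1m.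
    by apply: cvg_trans (n120 h'); exact: cvg_app.
  have m0 : m = 0.
    apply: qualified.
      exact: (normal_cone_ultra_limit UU ooU n1M xw n1A n1m).
    exact: (normal_cone_ultra_limit UU ooU n2M yw n2B n2m).
  by have := n1m h; rewrite m0.
have n20 : weak_star_cvg0 n2.
  by move=> h; rewrite n2E -[X in _ --> X](subrr 0); exact: cvgB.
by exists x, y, n1, n2; split=> //; split=> // k; have [_ []] := sP k.
Qed.

End extremal_sequences.

(** * The subdifferential sum rule for a convex function and a set indicator *)

Lemma dual_lineE {R : realType} (v : dual_space R^o) (r : R^o) : v r = r * v 1.
Proof. by rewrite -[in LHS](mulr1 r) -[r * 1]/(r *: (1 : R^o)) linearZ. Qed.

Section subdifferential_sum.
Context {R : realType} {Z : normedModType R}.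
Hypothesis completeZ : complete_space Z.
Variables (phi : Z -> \bar R) (G : set Z) (z : Z).
Hypothesis lsc_phi : lower_semicontinuous phi.
Hypothesis convex_phi : ereal_convex phi.
Hypothesis closedG : closed G.
Hypothesis convexG : convex_set G.
Hypothesis phi_gtNy : forall w, (-oo < phi w)%E.
Hypothesis phiz : phi z \is a fin_num.
Hypothesis Gz : G z.
Hypothesis qualification : forall u : dual_space Z,
  singular_subdifferential phi z u -> normal_cone G z (- u) -> u = 0.
Hypothesis compactness : SNEC phi z \/ SNC G z.

Variable zs : dual_space Z.
Hypothesis zs_sub : forall w, G w -> ((zs (w - z))%:E <= phi w - phi z)%E.

Let alpha := fine (phi z).
Let A := epigraph phi.
Let B := [set w : Z * R^o | G w.1 /\ w.2 <= alpha + zs (w.1 - z)].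

Let phizE : phi z = alpha%:E. Proof. by rewrite fineK. Qed.

Let closedB : closed B.
Proof.
apply: closedI.
  by apply: preimage_closed => // p _; exact: cvg_fst.
have cg : continuous (fun w : Z * R^o => w.2 - (alpha + zs (w.1 - z)) : R^o).
  move=> w; apply: cvgB; first exact: cvg_snd.
  apply: cvgD; first exact: cvg_cst.
  apply: (@cvg_comp _ _ _ (fun w : Z * R^o => w.1 - z) zs _ (nbhs (w.1 - z))).
    by apply: cvgB; [exact: cvg_fst|exact: cvg_cst].
  exact: dual_continuous.
rewrite [X in closed X](_ : _ =
    (fun w : Z * R^o => w.2 - (alpha + zs (w.1 - z)) : R^o)
      @^-1` [set r : R^o | r <= 0]).
  by apply: preimage_closed => // w _; exact: cg.
by apply/seteqP; split=> w /=; rewrite subr_le0.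
Qed.

Let convexB : convex_set B.
Proof.
apply/convex_setP => -[x r] [y s] t t0 t1 [/= Gx rx] [/= Gy sy].
split; first by move/convex_setP: convexG; exact.
have -> : (t *: (x, r : R^o) + (1 - t) *: (y, s : R^o)).1 - z =
    t *: (x - z) + (1 - t) *: (y - z).
  rewrite /= !scalerBr addrACA -opprD -scalerDl.
  by rewrite addrCA subrr addr0 scale1r.
have -> : zs (t *: (x - z) + (1 - t) *: (y - z)) =
    t * zs (x - z) + (1 - t) * zs (y - z) by rewrite linearP linearZ.
have := ler_wpM2l (ltW t0) rx; have /ler_wpM2l/(_ _ _ sy) : 0 <= 1 - t by lra.
rewrite /= /GRing.scale/=; lra.
Qed.

Let Az : A (z, alpha).
Proof. by rewrite /A /epigraph/= phizE. Qed.

Let Bz : B (z, alpha).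
Proof. by split=> //=; rewrite subrr linear0 addr0. Qed.

(** Raising [A] by [e] detaches it from [B]: over [G], [zs_sub] keeps [phi] on or above the affine
    function that bounds [B]. *)
Let extremal e : 0 < e -> exists2 a : Z * R^o, `|a| <= e &
  forall x y, A x -> B y -> x - y + a != 0.
Proof.
move=> e0; exists (0, e : R^o).
  by rewrite prod_normE/= normr0 gtr0_norm// ge_max lexx ltW.
move=> [x r] [y s] /= Ax [/= Gy sy]; apply/eqP => -[/eqP + rs].
rewrite addr0 subr_eq0 => /eqP xy; rewrite xy /A /epigraph/= in Ax.
have := zs_sub Gy; rewrite phizE leeBrDr// -EFinD => /le_trans/(_ Ax).
by rewrite lee_fin; move: rs; lra.
Qed.

Lemma subdifferential_sum : exists2 u : dual_space Z,
  subdifferential phi z u & normal_cone G z (zs - u).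
Proof.
(* Arguing by contradiction makes the absence of a splitting available in the proof of
   [qualified]. *)
apply: contrapT => nex.
have qualified (m : dual_space (Z * R^o)%type) : normal_cone A (z, alpha) m ->
    normal_cone B (z, alpha) (- m) -> m = 0.
  have [u [v ->]] := dual_pairP m => NA NB.
  have uvE h (r : R^o) : dual_pair u v (h, r) = u h + r * v 1.
    by rewrite -(dual_lineE v r).
  have mA w r : (phi w <= r%:E)%E -> u (w - z) + (r - alpha) * v 1 <= 0.
    by move=> /(NA (w, r)); rewrite uvE.
  (* Tested at the highest point of [B] above [w]. *)
  have mG w : G w -> 0 <= u (w - z) + zs (w - z) * v 1.
    move=> Gw; have /NB : B (w, alpha + zs (w - z)) by split.
    by rewrite dualNE oppr_le0 uvE/= addrAC subrr add0r.
  have v1 : v 1 <= 0.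
    by have := mA z (alpha + 1); rewrite subrr linear0 phizE lee_fin; lra.
  have [v10|v1n0] := eqVneq (v 1) 0.
    suff u0 : u = 0.
      by apply: dual_ext => -[h r]; rewrite uvE v10 mulr0 u0 addr0.
    apply: qualification.
      by move=> [w r] /mA; rewrite v10 mulr0.
    by move=> w /mG; rewrite v10 mulr0 addr0 dualNE oppr_le0.
  have v1lt : 0 < - v 1 by rewrite oppr_gt0 lt_neqAle v1n0.
  (* Scaling the vertical component to -1 turns the normal to the epigraph into a subgradient of
     [phi]. *)
  exfalso; apply: nex; exists ((- v 1)^-1 *: u) => [w|w Gw].
    have := phi_gtNy w; case phiw : (phi w) => [r| |//] _; last first.
      by rewrite phizE leey.
    rewrite phizE -EFinB lee_fin dualZE ler_pdivrMl//.
    by have := mA w r; rewrite phiw lee_fin; lra.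
  rewrite dualDE dualNE dualZE subr_le0 -ler_pdivrMl ?invr_gt0// invrK.
  by have := mG w Gw; lra.
have [x [y [n1 [n2 [[Ax By xz yz] [n1A n2B n12 [n10 n20] n1v]]]]]] :=
  extremal_sequences (complete_prod completeZ (@complete_spaceT _ R^o))
    (closed_epigraph lsc_phi) (convex_epigraph convex_phi) closedB convexB
    Az Bz extremal qualified.
have small (r : nat -> R) : r k @[k --> \oo] --> (0 : R^o) -> forall e, 0 < e ->
    \forall k \near \oo, `|r k| < e.
  by move=> r0 e e0; exact: cvgr0_norm_lt r0 _ e0.
(* In the SNEC case, an index with both [dual_norm (n1 k)] and [k.+1%:R^-1] below a quarter
   contradicts the lower bound [1 - k.+1%:R^-1]. *)
have e140 : 0 < 4^-1 :> R by lra.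
case: compactness => snc.
  have n1norm : dual_norm (n1 k) @[k --> \oo] --> (0 : R).
    exact: (snc x n1 Ax xz n1A n10).
  have [k [k1 k2]] := filter_ex (filterI (small _ n1norm _ e140)
    (small _ (@cvg_harmonic R) _ e140)).
  have [v v0 nv] := n1v k; have := le_trans nv (le_dual_norm (n1 k) v).
  rewrite ler_pM2r ?normr_gt0//.
  by move: k1 k2; rewrite !ltr_norml /harmonic/=; move: k.+1%:R^-1 => ?; lra.
(* Restricting [n2 k] to the graph of [zs] removes the slope of [B] and leaves a normal to [G], to
   which SNC applies. *)
have /choice[m mE] k : exists m : dual_space Z, forall h, m h = n2 k (h, zs h).
  have [u [v ->]] := dual_pairP (n2 k); exists (u + v 1 *: zs) => h.
  by rewrite dualDE dualZE mulrC -(dual_lineE v (zs h)).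
have n2E k h (r : R^o) : n2 k (h, r) = m k h + (r - zs h) * n2 k (0, 1).
  rewrite mE -[_ * n2 k _]linearZ/= -linearD/=; congr (n2 k _); congr pair.
    by rewrite /= scaler0 addr0.
  by rewrite /= [_ *: _]mulr1 subrKC.
have mG k : normal_cone G (y k).1 (m k).
  move=> w Gw; rewrite mE; have [_ yB] := By k.
  (* This point lies over [w] as far below the affine bound as [y k] does, and differs from [y k] by
     a vector in the graph of [zs]. *)
  have Bw : B (w, (y k).2 + zs (w - (y k).1)).
    split=> //=; rewrite -[w - z](subrKA (y k).1) linearD/=; lra.
  have := n2B k _ Bw; apply: le_trans; rewrite le_eqVlt; apply/orP; left; apply/eqP.
  by congr (n2 k _); congr pair; rewrite /= addrAC subrr add0r.
have m0 : weak_star_cvg0 m.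
  by move=> h; rewrite (_ : (fun k => m k h) = (fun k => n2 k (h, zs h)))//; apply/funext.
have y1z : (fun k => (y k).1) @ \oo --> z.
  by apply: cvg_comp yz _; exact: cvg_fst.
have mnorm : dual_norm (m k) @[k --> \oo] --> (0 : R).
  exact: (snc _ m (fun k => (By k).1) y1z mG m0).
have [M M0 zsM] := dual_bounded zs.
have M1 : 0 < M + 1 by lra.
(* The factor [M + 1] offsets the bound on [v.2 - zs v.1], so both terms of [n2 k v] are at most a
   quarter of [|v|]. *)
have e280 : 0 < 4^-1 / (M + 1) by rewrite divr_gt0.
have [k [[k1 k2] k3]] := filter_ex (filterI (filterI (small _ mnorm _ e140)
  (small _ (@cvg_harmonic R) _ e140)) (small _ (n20 (0, 1)) _ e280)).
have [v v0 nv] := n1v k.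
have vgt0 : 0 < `|v| by rewrite normr_gt0.
move: k3 => /=; rewrite ltr_pdivlMr// => k3.
have [v1 v2] := (norm_fst_le v, norm_snd_le v).
have mv : `|m k v.1| <= 4^-1 * `|v|.
  apply: le_trans (le_dual_norm _ _) _.
  apply: le_trans (ler_wpM2r (normr_ge0 _) (ler_norm _)) _.
  by apply: ler_pM => //; exact: ltW.
have lv : `|(v.2 - zs v.1) * n2 k (0, 1)| <= 4^-1 * `|v|.
  have : `|v.2 - zs v.1| <= (M + 1) * `|v|.
    apply: le_trans (ler_normB _ _) _; have := zsM v.1.
    by have := ler_wpM2l M0 v1; lra.
  rewrite normrM => /(ler_wpM2r (normr_ge0 (n2 k (0, 1))))/le_trans; apply.
  by rewrite mulrAC ler_wpM2r// mulrC ltW.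
have n2v : n2 k v = m k v.1 + (v.2 - zs v.1) * n2 k (0, 1).
  by rewrite -n2E -surjective_pairing.
(* With [c = k.+1%:R^-1], the estimates give [1 - c <= c + 1 / 2], which fails for [c] below a
   quarter. *)
have := n12 k v; have := ler_normB (n1 k v + n2 k v) (n2 k v); rewrite addrK.
have := ler_normD (m k v.1) ((v.2 - zs v.1) * n2 k (0, 1)); rewrite -n2v.
move: k2; rewrite ltr_norml /harmonic/= => /andP[_].
rewrite -(ltr_pM2r vgt0).
by move: nv mv lv; rewrite mulrBl; move: (k.+1%:R^-1) => c; lra.
Qed.

End subdifferential_sum.

(** * The subdifferential of the optimal value function *)

Theorem theorem3p8 (R : realType) (X Y : completeNormedModType R)
    (asplundX : asplund X) (asplundY : asplund Y)
    (F : X -> set Y) (closedF : closed (gph F)) (convexF : convex_set (gph F))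
    (phi : X * Y -> \bar R) (phi_gtNy : forall z, (-oo < phi z)%E)
    (lsc_phi : lower_semicontinuous phi) (convex_phi : ereal_convex phi)
    (mu_gtNy : forall x, (-oo < optimal_value phi F x)%E)
    (xb : X) (mu_xb : (optimal_value phi F xb < +oo)%E)
    (S_neq0 : solution_set phi F xb !=set0)
    (yb : Y) (yb_sol : solution_set phi F xb yb)
    (qualification :
      singular_subdifferential phi (xb, yb) `&`
        [set - f | f in normal_cone (gph F) (xb, yb)] = [set dual_pair 0 0])
    (compactness : SNEC phi (xb, yb) \/ SNC (gph F) (xb, yb)) :
  subdifferential (optimal_value phi F) xb =
  \bigcup_(uv in [set uv : dual_space X * dual_space Y |
                   subdifferential phi (xb, yb) (dual_pair uv.1 uv.2)])
    [set uv.1 + w | w in coderivative F (xb, yb) uv.2].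
Proof.
have [Fyb muE] := yb_sol.
have phi_fin : phi (xb, yb) \is a fin_num.
  by rewrite -muE fin_real// mu_xb mu_gtNy.
have mu_le x y : F x y -> (optimal_value phi F x <= phi (x, y))%E.
  by move=> Fxy; apply: ereal_inf_lbound; exists y.
apply/seteqP; split=> [xs xs_sub|_ [[u v]/= uv_sub] [w wN <-] x].
(* Because [yb] attains the infimum at [xb], [dual_pair xs 0] is a subgradient at [(xb, yb)] of the
   restriction of [phi] to [gph F]. *)
- have [||n n_sub nN] := @subdifferential_sum _ _
    (complete_prod (@complete_spaceT _ X) (@complete_spaceT _ Y))
    phi (gph F) (xb, yb) lsc_phi convex_phi closedF convexF phi_gtNy phi_fin
    Fyb _ compactness (dual_pair xs 0).
  + move=> n n_sing nN.
    suff : [set dual_pair (0 : dual_space X) (0 : dual_space Y)] n.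
      by move=> ->; apply: dual_ext => h /=; rewrite /dual_pair_fun/= addr0.
    by rewrite -qualification; split=> //; exists (- n) => //; rewrite opprK.
  + move=> [x y] Fxy; rewrite -muE.
    apply: le_trans (leeB (mu_le x y Fxy) (lexx _)).
    by have := xs_sub x; rewrite /= /dual_pair_fun/= addr0.
  have [u [v nE]] := dual_pairP n.
  exists (u, v); first by rewrite /= -nE.
  (* The remainder [dual_pair xs 0 - n] is [dual_pair (xs - u) (- v)], whose sign matches the
     coderivative at [v]. *)
  exists (xs - u); last by rewrite addrC subrK.
  rewrite /coderivative/= (_ : dual_pair _ _ = dual_pair xs 0 - n)//.
  apply: dual_ext => h; rewrite nE dualDE dualNE /= /dual_pair_fun.
  by rewrite dualDE !dualNE opprD addr0 addrA.
(* Conversely, for each [y] in [F x] the subgradient and normal cone inequalities add up, cancelling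
   the [v] terms. *)
- rewrite leeBrDr ?muE//; apply: le_ereal_inf_tmp => _ [y Fxy <-].
  have := uv_sub (x, y); rewrite -leeBrDr//; apply: le_trans.
  rewrite lee_fin.
  have : w (x - xb) - v (y - yb) <= 0 := wN (x, y) Fxy.
  by rewrite dualDE /= /dual_pair_fun/=; lra.
Qed.
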